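(* Let $G$ be a finite graph with average degree $d\ge 2$ and second order average degree $\widetilde{d}$, and let $w_0(uv)=(d(u)d(v))^{-1/2}$ for every edge $uv$ of $G$. Then for every natural number $r\ge 1$ there exists a vertex $v$ of $G$ such that $$\lambda_1(G(v,r),w_0)\ge \frac{2\sqrt{d-1}}{\widetilde{d}}\cos\left(\frac{\pi}{r+2}\right).$$
   Context: $d(u)$ denotes the degree of $u$ in $G$. The average degree of $G$ is $\sum_u d(u)/|V(G)|$ and its second order average degree is $\widetilde{d}=\sum_{u}d(u)^2/\sum_u d(u)$. The ball $G(v,r)$ is the subgraph of $G$ induced on vertices at distance at most $r$ from $v$, with the restricted weight $w_0$ (degrees in $w_0$ are always taken in $G$). $\lambda_1(H,w)$ denotes the spectral radius of the weighted adjacency matrix of $(H,w)$ (entry $w(uv)$ if $uv$ is an edge, $0$ otherwise). *)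

(* Defs.v *)
From HB Require Import structures.
From mathcomp Require Import all_boot all_order all_algebra.
From mathcomp Require Import all_classical all_reals.
From mathcomp Require Import trigo.
From mathcomp Require Import complex.
Set Implicit Arguments. Unset Strict Implicit. Unset Printing Implicit Defensive.
Import Order.TTheory GRing.Theory Num.Theory.
Local Open Scope ring_scope.

Definition simple_graph (T : finType) (e : rel T) : Prop :=
  symmetric e /\ irreflexive e.

Definition deg (T : finType) (e : rel T) (u : T) : nat := #|[set x | e u x]|.

Definition avg_deg (R : realType) (T : finType) (e : rel T) : R :=
  (\sum_(u : T) deg e u)%:R / #|T|%:R.

Definition avg_deg2 (R : realType) (T : finType) (e : rel T) : R :=
  (\sum_(u : T) (deg e u) ^ 2)%:R / (\sum_(u : T) deg e u)%:R.

Definition w0 (R : realType) (T : finType) (e : rel T) (u v : T) : R :=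
  (Num.sqrt ((deg e u * deg e v)%:R))^-1.

Fixpoint ball (T : finType) (e : rel T) (v : T) (r : nat) : {set T} :=
  match r with
  | 0 => [set v]
  | k.+1 => ball e v k :|: [set y | [exists x in ball e v k, e x y]]
  end.

Definition wadj_induced (R : realType) (T : finType) (e : rel T)
    (w : T -> T -> R) (B : {set T}) : 'M[R]_(#|B|) :=
  \matrix_(i, j) (if e (enum_val i) (enum_val j)
                  then w (enum_val i) (enum_val j) else 0).

Definition spectral_radius (R : realType) (n : nat) (A : 'M[R]_n) : R :=
  sup [set Normc.normc z | z in [set z : R[i] |
         eigenvalue (map_mx (real_complex R) A) z]]%classic.

Definition lambda1_ball (R : realType) (T : finType) (e : rel T)
    (v : T) (r : nat) : R :=
  spectral_radius (wadj_induced e (w0 R e) (ball e v r)).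

(* Main.v *)
(** Run the non-backtracking walk on directed edges, allowing it to turn back at
vertices of degree one; its stationary law is uniform on directed edges.
Started at a directed edge [s] and stopped after [r] steps, it gives a test
vector on the ball around the head of [s]: the squared entry at [y] is the
probability of being at [y] after [i] steps, weighted by [x i ^+ 2] and summed
over [i], with [x i = sin ((i + 1) pi / (r + 2))] the Perron vector of a path on
[r + 1] vertices.  By Cauchy-Schwarz along each edge, the Rayleigh quotients,
averaged over [s], are at least [2 cos (pi / (r + 2))] times the mean of
[sqrt (M y) / sqrt (D y * D z)] over directed edges [(y, z)], where [M] is
[max (deg - 1, 1)] and [D] is [max (deg, 2)]: a leaf has to be counted with degree
two, because walks cross its edge twice in a row.  Jensen's inequality for
[ln] and for [u ln (u - 1) / 2] bounds this mean below by [sqrt (d - 1)] over the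
second order average degree; the loss [ln 2] at each leaf is paid for by the gap, at least
one, between the convex function and its tangent there. *)

Require Import Defs.
From HB Require Import structures.
From mathcomp Require Import all_boot all_order all_algebra.
From mathcomp Require Import all_classical all_reals.
From mathcomp Require Import trigo.
From mathcomp Require Import complex.
From mathcomp Require Import spectral.
From mathcomp Require Import topology normedtype derive exp.
From mathcomp Require Import ring lra.
Import numFieldNormedType.Exports.
(* [ball] must denote the graph ball, not the metric one. *)
Import Defs.
Import Order.TTheory GRing.Theory Num.Theory.
Local Open Scope ring_scope.

(** * Logarithmic inequalities behind the Jensen step *)

Lemma ln_le_subr1 (R : realType) (x : R) : 0 < x -> ln x <= x - 1.
Proof. by move=> x0; have := @le_ln1Dx R (x - 1); rewrite subrKC; apply; lra. Qed.

(** With [a = d - 1] and [a * z = u - 1] this is the tangent at [u = d] of [u ln (u - 1)], convex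
    for [u >= 2]; the condition [a^-1 <= z] is [u >= 2]. The difference vanishes at 1, and its
    derivative [dh] is nonpositive before 1 and nonnegative after. *)
Lemma affine_mul_ln_ge (R : realType) (a z : R) : 1 <= a -> a^-1 <= z ->
  (a + 1) * (z - 1) <= (a * z + 1) * ln z.
Proof.
move=> a1 az; have a0 : 0 < a by lra.
have z0 : 0 < z by apply: lt_le_trans az; rewrite invr_gt0.
have a1' : a^-1 <= 1 by rewrite invf_le1.
have avz (x : R) : a^-1 <= x -> 1 <= a * x by rewrite -ler_pdivrMl// mulr1.
pose h (x : R) := (a * x + 1) * ln x - (a + 1) * (x - 1).
pose dh (x : R) := a * ln x + x^-1 - 1.
have dhE (x : R) : 0 < x -> is_derive x 1 h (dh x).
  move=> x0; have dln := is_derive1_ln x0.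
  apply: is_derive_eq; rewrite /dh /GRing.scale /=.
  by field; lra.
have hc (u v : R) : 0 < u -> {within `[u, v], continuous h}%classic.
  move=> u0; apply: derivable_within_continuous => x.
  rewrite in_itv/= => /andP[ux _]; by have [] := dhE x ltac:(lra).
suff : 0 <= h z by rewrite /h; lra.
have h1 : h 1 = 0 by rewrite /h ln1; ring.
have [z1|z1] := lerP 1 z.
  have [|c] := @MVT_segment R h dh 1 z z1 _ (hc _ _ ltr01).
    by move=> x; rewrite in_itv/= => /andP[x1 _]; apply: dhE; lra.
  rewrite in_itv/= h1 subr0 => /andP[c1 _] ->.
  apply: mulr_ge0; last lra.
  have := @ln_le_subr1 R c^-1; rewrite lnV ?posrE ?invr_gt0; last lra.
  move=> /(_ ltac:(lra)); rewrite /dh.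
  have : c^-1 <= 1 by rewrite invf_le1; lra.
  by nra.
have [|c] := @MVT_segment R h dh z 1 (ltW z1) _ (hc _ _ z0).
  by move=> x; rewrite in_itv/= => /andP[x1 _]; apply: dhE; lra.
rewrite in_itv/= h1 sub0r => /andP[c1 c2] hE.
suff : dh c <= 0 by nra.
have c0 : 0 < c by lra.
have := ln_le_subr1 _ _ c0; have := avz c ltac:(lra).
rewrite /dh => ac lc.
apply: (@le_trans _ _ (a * (c - 1) + c^-1 - 1)); first by nra.
have -> : a * (c - 1) + c^-1 - 1 = (1 - c) * (1 - a * c) / c by field; lra.
rewrite pmulr_lle0 ?invr_gt0//; nra.
Qed.

(* [n] is the degree of a vertex; summed over all vertices, the terms
   [n%:R - d] and [n%:R * (n%:R / t - 1)] cancel. *)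
Lemma degree_log_tangent (R : realType) (n : nat) (d t : R) : 2 <= d -> 0 < t ->
  n%:R * (ln (d - 1) / 2 - ln t) + (n%:R - d) * (d / (d - 1)) / 2
    - n%:R * (n%:R / t - 1)
  <= n%:R * (ln (maxn n.-1 1)%:R / 2 - ln (maxn n 2)%:R).
Proof.
move=> d2 t0; have d1 : 0 < d - 1 by lra.
case: n => [|[|n]].
- rewrite !mul0r add0r subr0 sub0r.
  have : 0 <= d * (d / (d - 1)) by rewrite !mulr_ge0// ?invr_ge0; lra.
  lra.
- have -> : maxn 1.-1 1 = 1%N by [].
  have -> : maxn 1 2 = 2%N by [].
  rewrite ln1.
  (* At a leaf the tangent has slack: [ln (d - 1) / 2 - d / 2 <= -1], which absorbs the loss
     [ln 2 <= 1]. *)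
  have h1 := ln_le_subr1 _ _ d1; have h2 := @ln_le_subr1 R 2 ltac:(lra).
  have h3 := @ln_le_subr1 R t^-1; rewrite lnV ?invr_gt0 ?posrE// in h3.
  have {}h3 := h3 t0.
  have -> : (1 - d) * (d / (d - 1)) = - d by field; lra.
  lra.
set k := n.+2.
have -> : maxn k.-1 1 = n.+1 by [].
have -> : maxn k 2 = k by [].
have k2 : 2 <= k%:R :> R by rewrite ler_nat.
have n1 : n.+1%:R = k%:R - 1 :> R by rewrite /k -[n.+2]add1n natrD addrAC subrr add0r.
rewrite n1; move: {n1}(k%:R : R) k2 => x x2.
have h3 := @ln_le_subr1 R (x / t); rewrite ln_div ?posrE// in h3; last lra.
have {}h3 := h3 ltac:(by rewrite divr_gt0//; lra).
have := @affine_mul_ln_ge R (d - 1) ((x - 1) / (d - 1)).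
rewrite ln_div ?posrE//; last lra.
move=> /(_ ltac:(lra)).
have le1 : (d - 1)^-1 <= (x - 1) / (d - 1) by rewrite ler_peMl ?invr_ge0; lra.
move=> /(_ le1).
have -> : (d - 1 + 1) * ((x - 1) / (d - 1) - 1) = (x - d) * (d / (d - 1)).
  by field; lra.
have -> : (d - 1) * ((x - 1) / (d - 1)) + 1 = x by field; lra.
move: ((x - d) * _) (ln (x - 1)) (ln (d - 1)) (ln x) (ln t) (x / t) h3 => A B C D E F.
nra.
Qed.

(** * Rayleigh quotients and the spectral radius *)

Lemma normcCE (R : realType) (z : R[i]) : `|z| = (Normc.normc z)%:C%C.
Proof. by case: z. Qed.

Lemma normc_eigenvalue_le (R : realType) (n : nat) (A : 'M[R]_n) (z : R[i]) :
  eigenvalue (map_mx (real_complex R) A) z ->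
  Normc.normc z <= spectral_radius A.
Proof.
move=> zA; apply: ub_le_sup; last by exists z.
set B := map_mx _ A.
have [rs] := closed_field_poly_normal (char_poly B).
rewrite (monicP (char_poly_monic B)) scale1r => BE.
(* [sup] dominates its set only if the set is bounded; the sum of the moduli of all roots is a crude
   bound. *)
exists (\sum_(t <- rs) Normc.normc t) => _ [t /= tB <-].
move: tB; rewrite eigenvalue_root_char -/B BE root_prod_XsubC => trs.
have normc_ge0 (u : R[i]) : 0 <= Normc.normc u by case: u => a b; exact: sqrtr_ge0.
by rewrite (big_rem t)//= lerDl; apply: sumr_ge0 => u _.
Qed.

(** In a unitary eigenbasis over [R[i]] the quadratic form is a combination of eigenvalues with
    nonnegative weights summing to the squared norm; bounding their moduli suffices. *)
Lemma rayleigh_le_spectral_radius (R : realType) (n : nat) (A : 'M[R]_n)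
    (l : R) (F : 'rV[R]_n) : A^T = A -> F != 0 ->
  l * (\sum_i F 0 i ^+ 2) <= \sum_i \sum_j F 0 i * A i j * F 0 j ->
  l <= spectral_radius A.
Proof.
move=> symA F0 lF.
set B := map_mx (real_complex R) A; set f := map_mx (real_complex R) F.
have realB : B \is a mxOver Num.real.
  by apply/mxOverP => i j; rewrite mxE complex_real.
have symB : B \is symmetricmx.
  by apply/is_hermitianmxP; rewrite expr0 scale1r map_mx_id//;
    apply/matrixP => i j; rewrite !mxE -{1}symA mxE.
have /orthomx_spectralP BE := symmetric_normalmx symB realB.
set P := spectralmx B in BE; set D := spectral_diag B in BE.
have Pu : P \is unitarymx := spectral_unitarymx B.
have Punit : P \in unitmx := spectral_unit B.
have eigD k : Normc.normc (D 0 k) <= spectral_radius A.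
  apply: normc_eigenvalue_le; apply/eigenvalueP; exists (row k P).
    rewrite -/B BE -row_mul !mulmxA mulmxV// mul1mx row_mul row_diag_mx.
    by rewrite -scalemxAl -rowE.
  apply/eqP => Pk; have := mulmxV Punit.
  move=> /(congr1 (row k)); rewrite row_mul Pk mul0mx => /rowP/(_ k).
  by rewrite !mxE eqxx => /eqP; rewrite eq_sym oner_eq0.
pose g := f *m (P ^t*)%sesqui.
have fE : f = g *m P by rewrite /g mulmxKtV.
have ff : (f *m (f ^t*)%sesqui) 0 0 = (\sum_i F 0 i ^+ 2)%:C%C.
  rewrite mxE rmorph_sum; apply: eq_bigr => i _.
  rewrite !mxE; rewrite (CrealP _) ?complex_real// rmorphXn/=.
  by rewrite expr2.
have fBf : (f *m B *m (f ^t*)%sesqui) 0 0 =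
    (\sum_i \sum_j F 0 i * A i j * F 0 j)%:C%C.
  rewrite mxE exchange_big rmorph_sum; apply: eq_bigr => j _.
  rewrite !mxE (CrealP _) ?complex_real// rmorph_sum mulr_suml.
  by apply: eq_bigr => i _; rewrite !mxE !rmorphM.
have gg : (g *m (g ^t*)%sesqui) 0 0 = \sum_k `|g 0 k| ^+ 2.
  by rewrite mxE; apply: eq_bigr => k _; rewrite !mxE normCK.
have ftE : (f ^t*)%sesqui = (P ^t*)%sesqui *m (g ^t*)%sesqui.
  by rewrite fE trmx_mul map_mxM.
have ff' : f *m (f ^t*)%sesqui = g *m (g ^t*)%sesqui.
  by rewrite ftE fE mulmxA mulmxtVK.
have fBf' : (f *m B *m (f ^t*)%sesqui) 0 0 = \sum_k D 0 k * `|g 0 k| ^+ 2.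
  rewrite ftE BE fE !mulmxA mulmxtVK// mulmxK// mul_mx_diag mxE.
  apply: eq_bigr => k _; rewrite !mxE normCK; ring.
have N0 : 0 < \sum_i F 0 i ^+ 2.
  rewrite lt_def sumr_ge0 ?andbT; last by move=> i _; apply: sqr_ge0.
  apply: contra F0 => /eqP/psumr_eq0P F2; apply/eqP/rowP => i.
  rewrite mxE; apply/eqP; rewrite -sqrf_eq0; apply/eqP/F2 => // j _.
  exact: sqr_ge0.
rewrite -(ler_pM2r N0); apply: le_trans lF _.
rewrite -lecR -fBf.
apply: le_trans (_ : _ <= `|(f *m B *m (f ^t*)%sesqui) 0 0|) _.
  by rewrite real_ler_norm// fBf complex_real.
rewrite fBf' rmorphM/= -ff ff' gg mulr_sumr.
apply: le_trans (ler_norm_sum _ _ _) _; apply: ler_sum => k _.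
rewrite normrM [`|_ ^+ 2|]ger0_norm ?exprn_ge0// ler_wpM2r ?exprn_ge0//.
by rewrite normcCE lecR.
Qed.

(** * Finite sums: Cauchy-Schwarz, sines, averaging *)

Lemma sum_mul_le_sqrt (R : realType) (I : finType) (a b : I -> R) :
  \sum_i a i * b i <=
  Num.sqrt (\sum_i a i ^+ 2) * Num.sqrt (\sum_i b i ^+ 2).
Proof.
have sum_sq0 (f : I -> R) : \sum_i f i ^+ 2 <= 0 -> forall i, f i = 0.
  move=> f0 i; apply/eqP; rewrite -sqrf_eq0; apply/eqP.
  apply: (psumr_eq0P (P := xpredT) (F := fun i => f i ^+ 2)) => //.
    by move=> j _; exact: sqr_ge0.
  by apply/le_anti; rewrite f0 sumr_ge0// => j _; exact: sqr_ge0.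
have [A0|A0] := lerP (\sum_i a i ^+ 2) 0.
  rewrite big1 ?mulr_ge0 ?sqrtr_ge0// => i _.
  by rewrite (sum_sq0 _ A0) mul0r.
have [B0|B0] := lerP (\sum_i b i ^+ 2) 0.
  rewrite big1 ?mulr_ge0 ?sqrtr_ge0// => i _.
  by rewrite (sum_sq0 _ B0) mulr0.
set p := Num.sqrt _; set q := Num.sqrt _.
have p0 : 0 < p by rewrite sqrtr_gt0.
have q0 : 0 < q by rewrite sqrtr_gt0.
have pE : p ^+ 2 = \sum_i a i ^+ 2 by rewrite sqr_sqrtr// ltW.
have qE : q ^+ 2 = \sum_i b i ^+ 2 by rewrite sqr_sqrtr// ltW.
have pq0 : 0 < 2 * (p * q) by rewrite !mulr_gt0.
rewrite -(ler_pM2l pq0) mulr_sumr.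
apply: le_trans (_ : _ <= \sum_i (a i ^+ 2 * q ^+ 2 + b i ^+ 2 * p ^+ 2)) _.
  apply: ler_sum => i _; have := sqr_ge0 (a i * q - b i * p); nra.
by rewrite big_split/= -!mulr_suml -pE -qE; nra.
Qed.

(** Induction on the three-term recurrence of the sines. For [t = pi / (r + 2)] the boundary term
    vanishes, leaving the path eigenvalue [2 * cos t]. *)
Lemma sum_sin_mul_succ (R : realType) (t : R) (r : nat) :
  2 * (\sum_(i < r) sin (i.+1%:R * t) * sin (i.+2%:R * t))
    + sin (r.+1%:R * t) * sin (r.+2%:R * t) =
  2 * cos t * \sum_(i < r.+1) sin (i.+1%:R * t) ^+ 2.
Proof.
have rec k : sin (k.+2%:R * t) = 2 * cos t * sin (k.+1%:R * t) - sin (k%:R * t).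
  have -> : k.+2%:R * t = k.+1%:R * t + t by rewrite -[k.+2]addn1 natrD mulrDl mul1r.
  have -> : k%:R * t = k.+1%:R * t - t by rewrite -[k.+1]addn1 natrD; ring.
  by rewrite sinD sinB; ring.
elim: r => [|r IH].
  by rewrite big_ord0 big_ord1 rec mul0r sin0; ring.
rewrite big_ord_recr/= [in RHS]big_ord_recr/= [in RHS]mulrDr -IH (rec r.+1); ring.
Qed.

Lemma ex_le_of_sum_le (R : realType) (I : finType) (P : pred I) (f g : I -> R) :
  (exists i, P i) -> \sum_(i | P i) f i <= \sum_(i | P i) g i ->
  exists2 i, P i & f i <= g i.
Proof.
move=> [i0 Pi0] fg.
case: (boolP [exists i, P i && (f i <= g i)]) => [/existsP[i /andP[]]|].
  by exists i.
rewrite negb_exists => /forallP gf.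
suff : \sum_(i | P i) g i < \sum_(i | P i) f i by rewrite ltNge fg.
apply: ltr_sum => [|i Pi]; first by apply/hasP; exists i0; rewrite ?mem_index_enum.
by have := gf i; rewrite Pi ltNge.
Qed.

(** * The reflecting walk and its stationary law *)

Section ReflectingWalk.
Variables (R : realType) (T : finType) (e : rel T).
Hypothesis sym_e : symmetric e.

Definition branching (y : T) : nat := maxn (deg e y).-1 1.

Definition walk_step (x y z : T) : bool :=
  [&& e x y, e y z & (x != z) || (deg e y == 1)].

(* Probability that the walk started at the directed edge [s] traverses [(y, z)] at step [i]. *)
Fixpoint walk_mass (s : T * T) (i : nat) (y z : T) : R :=
  if i is k.+1
  then (\sum_(x | walk_step x y z) walk_mass s k x y) / (branching y)%:R
  else ((y, z) == s)%:R.

(** The mass at [y] allowed to continue to [z], before it is split evenly among [branching y]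
    continuations. *)
Definition inflow (s : T * T) (i : nat) (y z : T) : R :=
  \sum_(x | walk_step x y z) walk_mass s i x y.

Definition load (x : nat -> R) (r : nat) (s : T * T) (y : T) : R :=
  \sum_(i < r.+1) x i ^+ 2 * \sum_z walk_mass s i z y.

(* Multiplicity of the local folding of the tree of walks onto the graph: two walk
   steps around a leaf lie over the same edge. *)
Definition fold_degree (y : T) : nat := if deg e y == 1 then 2 else 1.

Definition adj_weight (y z : T) : R :=
  (Num.sqrt (maxn (deg e y) 2 * maxn (deg e z) 2)%:R)^-1.

Lemma deg_gt0 y z : e y z -> (0 < deg e y)%N.
Proof. by move=> yz; apply/card_gt0P; exists z; rewrite inE. Qed.

Lemma branching_gt0 y : 0 < (branching y)%:R :> R.
Proof. by rewrite ltr0n leq_max orbT. Qed.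

(** Predecessors are counted here; their number equals that of the successors used to split the
    mass, which makes the uniform law stationary. *)
Lemma card_walk_step y z : e y z -> #|[set x | walk_step x y z]| = branching y.
Proof.
move=> yz; rewrite /branching; have [d1|d1] := eqVneq (deg e y) 1%N.
  rewrite d1 /= -[RHS]d1; apply: eq_card => x.
  by rewrite !inE /walk_step yz d1 eqxx orbT /= andbT sym_e.
have -> : [set x | walk_step x y z] = [set x | e y x] :\ z.
  by apply/setP => x; rewrite !inE /walk_step yz (negbTE d1) orbF/= andbC sym_e.
have dE : deg e y = #|[set x | e y x] :\ z|.+1 by rewrite /deg (cardsD1 z) inE yz.
apply/esym; rewrite dE; apply/maxn_idPl.
by move: d1; rewrite dE eqSS lt0n.
Qed.

Lemma walk_mass_ge0 s i y z : 0 <= walk_mass s i y z.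
Proof.
elim: i y z => [|i IH] y z /=; first exact: ler0n.
by rewrite divr_ge0 ?ler0n// sumr_ge0.
Qed.

Lemma inflow_ge0 s i y z : 0 <= inflow s i y z.
Proof. by apply: sumr_ge0 => x _; exact: walk_mass_ge0. Qed.

Lemma load_ge0 x r s y : 0 <= load x r s y.
Proof.
apply: sumr_ge0 => i _; rewrite mulr_ge0 ?sqr_ge0// sumr_ge0// => z _.
exact: walk_mass_ge0.
Qed.

Lemma sum_walk_mass i y z :
  \sum_(s | e s.1 s.2) walk_mass s i y z = (e y z)%:R.
Proof.
elim: i y z => [|i IH] y z /=.
  rewrite big_mkcond (bigD1 (y, z))//= eqxx big1 ?addr0; first by case: (e y z).
  by move=> s sne; rewrite [_ == s]eq_sym (negbTE sne) if_same.
rewrite -mulr_suml exchange_big/=.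
under eq_bigr => x /andP[xy _] do rewrite IH xy.
case: (boolP (e y z)) => yz; last first.
  by rewrite big1 ?mul0r// => x; rewrite /walk_step (negbTE yz) andbF.
rewrite -(card_walk_step _ _ yz) -sum1_card natr_sum.
have -> : \sum_(x | walk_step x y z) 1%:R =
          \sum_(x in [set x | walk_step x y z]) 1%:R :> R.
  by apply: eq_bigl => x; rewrite inE.
by rewrite divff// -natr_sum sum1_card card_walk_step// gt_eqF// branching_gt0.
Qed.

Lemma sum_inflow i y z :
  \sum_(s | e s.1 s.2) inflow s i y z = (e y z)%:R * (branching y)%:R.
Proof.
rewrite -(sum_walk_mass i.+1) mulr_suml; apply: eq_bigr => s _ /=.
by rewrite divfK// gt_eqF// branching_gt0.
Qed.

Lemma sum_deg : (\sum_u deg e u)%:R = \sum_y \sum_(z | e y z) 1 :> R.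
Proof.
rewrite natr_sum; apply: eq_bigr => y _.
rewrite /deg -sum1_card natr_sum; apply: eq_bigl => z.
by rewrite inE.
Qed.

Lemma sum_load x r :
  \sum_(s | e s.1 s.2) \sum_y load x r s y =
  (\sum_(i < r.+1) x i ^+ 2) * (\sum_u deg e u)%:R.
Proof.
rewrite sum_deg /load; under eq_bigr do rewrite exchange_big/=.
rewrite exchange_big/= mulr_suml; apply: eq_bigr => i _.
under eq_bigr do rewrite -mulr_sumr.
rewrite -mulr_sumr exchange_big/=; congr (_ * _).
transitivity (\sum_y \sum_z (e z y)%:R : R).
  apply: eq_bigr => y _; rewrite exchange_big/=; apply: eq_bigr => z _.
  exact: sum_walk_mass.
apply: eq_bigr => y _; rewrite [RHS]big_mkcond/=; apply: eq_bigr => z _.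
by rewrite sym_e; case: (e y z).
Qed.

(** * Edgewise Cauchy-Schwarz and the summed Rayleigh form *)

Lemma inflow_add_mass_le s i y z : e y z ->
  inflow s i y z + walk_mass s i z y <=
  (fold_degree y)%:R * \sum_x walk_mass s i x y.
Proof.
move=> yz; rewrite /inflow /fold_degree big_mkcond.
rewrite [in X in _ <= X](bigD1 z)//= (bigD1 z)//=.
have le_rest : \sum_(x | x != z)
    (if walk_step x y z then walk_mass s i x y else 0) <=
    \sum_(x | x != z) walk_mass s i x y.
  by apply: ler_sum => x _; case: ifP => // _; exact: walk_mass_ge0.
have rest_ge0 : 0 <= \sum_(x | x != z) walk_mass s i x y.
  by apply: sumr_ge0 => x _; exact: walk_mass_ge0.
have m0 := walk_mass_ge0 s i z y.
(* Mass arriving from [z] cannot return to [z] unless [y] is a leaf; there it is counted twice,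
   hence the factor 2. *)
rewrite {1}/walk_step eqxx/=; case: (deg e y == 1); last by rewrite !andbF/=; lra.
by case: ifP => _ /=; lra.
Qed.

Lemma edge_bound (x : nat -> R) r s y z : e y z ->
  \sum_(i < r) x i * x i.+1 *
     (inflow s i y z / Num.sqrt (branching y)%:R
      + inflow s i z y / Num.sqrt (branching z)%:R)
  <= Num.sqrt ((fold_degree y)%:R * load x r s y)
     * Num.sqrt ((fold_degree z)%:R * load x r s z).
Proof.
move=> yz; have zy : e z y by rewrite sym_e.
(* [inl i] stands for steps from [y] to [z], [inr i] for steps from [z] to [y]. *)
pose u (y z : T) (j : 'I_r + 'I_r) := match j with
  | inl i => x i * Num.sqrt (inflow s i y z)
  | inr i => x i.+1 * Num.sqrt (walk_mass s i.+1 z y) end.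
pose v (y z : T) (j : 'I_r + 'I_r) := match j with
  | inl i => x i.+1 * Num.sqrt (walk_mass s i.+1 y z)
  | inr i => x i * Num.sqrt (inflow s i z y) end.
have uE (y' z' : T) : e y' z' -> \sum_j u y' z' j ^+ 2 <=
    (fold_degree y')%:R * load x r s y'.
  move=> yz'; rewrite /load mulr_sumr.
  apply: le_trans (_ : _ <= \sum_(i < r.+1)
     x i ^+ 2 * (inflow s i y' z' + walk_mass s i z' y')) _; last first.
    apply: ler_sum => i _; rewrite mulrCA ler_wpM2l ?sqr_ge0//.
    exact: inflow_add_mass_le.
  (* Departures towards [z] use times [0..r-1] and arrivals from [z] use times [1..r], so the last
     inflow term and the first mass term are dropped. *)
  under [X in _ <= X]eq_bigr do rewrite mulrDr.
  rewrite big_split big_sumType/= lerD//.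
    rewrite big_ord_recr/= -[leLHS]addr0 lerD//.
      apply: ler_sum => i _.
      by rewrite exprMn sqr_sqrtr ?inflow_ge0.
    by rewrite mulr_ge0 ?sqr_ge0 ?inflow_ge0.
  rewrite big_ord_recl/= -[leLHS]add0r lerD//.
    by rewrite mulr_ge0 ?sqr_ge0 ?ler0n.
  by apply: ler_sum => i _; rewrite exprMn sqr_sqrtr ?(walk_mass_ge0 _ i.+1).
have vE : \sum_j v y z j ^+ 2 = \sum_j u z y j ^+ 2.
  by rewrite !big_sumType/= addrC.
(* The mass at step [i.+1] is the inflow over [branching], so their geometric mean is the inflow
   over its square root. *)
have massE (y' z' : T) i : inflow s i y' z' / Num.sqrt (branching y')%:R =
    Num.sqrt (inflow s i y' z') * Num.sqrt (walk_mass s i.+1 y' z').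
  rewrite /= sqrtrM ?inflow_ge0// mulrA -expr2 sqr_sqrtr ?inflow_ge0//.
  by rewrite sqrtrV// ler0n.
apply: le_trans (_ : _ <= \sum_j u y z j * v y z j) _.
  rewrite big_sumType/= -big_split/=; apply: ler_sum => i _.
  by rewrite !massE le_eqVlt; apply/orP; left; apply/eqP; rewrite /=; ring.
apply: le_trans (sum_mul_le_sqrt _ _ _ _) _.
by rewrite vE ler_pM ?sqrtr_ge0// ler_wsqrtr// uE.
Qed.

Lemma w0_fold y z : e y z ->
  w0 R e y z = adj_weight y z * (Num.sqrt (fold_degree y)%:R * Num.sqrt (fold_degree z)%:R).
Proof.
move=> yz; have zy : e z y by rewrite sym_e.
have fE u v : e u v -> maxn (deg e u) 2 = (fold_degree u * deg e u)%N.
  move=> /deg_gt0; rewrite /fold_degree; case: (deg e u) => [//|[//|n]] _.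
  by rewrite mul1n; apply/maxn_idPl.
have f0 u : 0 < (fold_degree u)%:R :> R.
  by rewrite ltr0n /fold_degree; case: ifP.
have sqrtnM (a b : nat) : Num.sqrt (a * b)%:R = Num.sqrt a%:R * Num.sqrt b%:R :> R.
  by rewrite natrM sqrtrM ?ler0n.
rewrite /w0 /adj_weight (fE _ _ yz) (fE _ _ zy) mulnACA -sqrtnM.
rewrite [X in _ = X^-1 * _]sqrtnM invfM mulrAC mulVf ?mul1r//.
by rewrite gt_eqF// sqrtr_gt0 natrM mulr_gt0.
Qed.

Lemma sum_edges_swap (f : T -> T -> R) :
  \sum_y \sum_(z | e y z) f z y = \sum_y \sum_(z | e y z) f y z.
Proof.
rewrite (exchange_big_dep xpredT)//=; apply: eq_bigr => y _.
by apply: eq_bigl => z; rewrite sym_e.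
Qed.

(** Summing [edge_bound] over all starts replaces each inflow by [branching y], by stationarity; the
    factor 2 comes from the two orientations of an edge. *)
Lemma sum_rayleigh_ge (x : nat -> R) r :
  2 * (\sum_(i < r) x i * x i.+1) *
    (\sum_y \sum_(z | e y z) adj_weight y z * Num.sqrt (branching y)%:R) <=
  \sum_(s | e s.1 s.2) \sum_y \sum_(z | e y z)
     Num.sqrt (load x r s y) * w0 R e y z * Num.sqrt (load x r s z).
Proof.
pose h s i y z := adj_weight y z *
  (x i * x i.+1 * (inflow s i y z / Num.sqrt (branching y)%:R)).
have awC y z : adj_weight y z = adj_weight z y by rewrite /adj_weight mulnC.
have fd0 y : 0 <= (fold_degree y)%:R :> R by exact: ler0n.
apply: le_trans (_ : _ <= \sum_(s | e s.1 s.2) \sum_y \sum_(z | e y z)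
   (\sum_(i < r) h s i y z + \sum_(i < r) h s i z y)) _; last first.
  apply: ler_sum => s _; apply: ler_sum => y _; apply: ler_sum => z yz.
  have /(ler_wpM2l (_ : 0 <= adj_weight y z)) := edge_bound x r s y z yz.
  rewrite {1}/adj_weight invr_ge0 sqrtr_ge0 => /(_ isT) le_edge.
  apply: le_trans (le_trans _ le_edge) _.
    rewrite mulr_sumr -big_split/=; apply: ler_sum => i _.
    by rewrite /h (awC z y) -!mulrDr.
  rewrite (w0_fold _ _ yz) !(sqrtrM _ (fd0 _)) le_eqVlt; apply/orP; left.
  by apply/eqP; ring.
have swapE s : \sum_y \sum_(z | e y z)
    (\sum_(i < r) h s i y z + \sum_(i < r) h s i z y) =
    (\sum_y \sum_(z | e y z) \sum_(i < r) h s i y z) *+ 2.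
  under eq_bigr do rewrite big_split/=.
  by rewrite big_split/= (sum_edges_swap (fun y z => \sum_(i < r) h s i y z)).
under [leRHS]eq_bigr do rewrite swapE.
rewrite sumrMnl -[leRHS]mulr_natl -mulrA ler_pM2l// [leRHS]exchange_big/=.
rewrite mulr_sumr; apply: ler_sum => y _.
rewrite [leRHS]exchange_big/= mulr_sumr; apply: ler_sum => z yz.
rewrite [leRHS]exchange_big/= mulr_suml; apply: ler_sum => i _.
rewrite -mulr_sumr -mulr_sumr -mulr_suml sum_inflow yz mul1r.
rewrite le_eqVlt; apply/orP; left; apply/eqP.
have -> : (branching y)%:R / Num.sqrt (branching y)%:R = Num.sqrt (branching y)%:R :> R.
  rewrite -{1}[_%:R]sqr_sqrtr ?ler0n// expr2 mulfK// gt_eqF// sqrtr_gt0.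
  exact: branching_gt0.
by ring.
Qed.

(** * Support of the test vector in a ball *)

Lemma ball_subset (v : T) i j : (i <= j)%N -> ball e v i \subset ball e v j.
Proof.
elim: j i => [|j IH] i; first by rewrite leqn0 => /eqP->.
rewrite leq_eqVlt => /predU1P[->//|ij].
exact: fintype.subset_trans (IH _ ij) (finset.subsetUl _ _).
Qed.

Lemma walk_mass_out_ball s i y z : z \notin ball e s.2 i -> walk_mass s i y z = 0.
Proof.
elim: i y z => [|i IH] y z /=.
  by case: eqP => [<-|//]; rewrite inE eqxx.
rewrite !inE negb_or => /andP[_ /existsPn zb].
rewrite big1 ?mul0r// => x /and3P[_ yz _]; apply: IH.
by apply: contra (zb y) => ->.
Qed.

Lemma load_out_ball x r s y : y \notin ball e s.2 r -> load x r s y = 0.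
Proof.
move=> yb; rewrite /load big1// => i _; rewrite big1 ?mulr0// => z _.
apply: walk_mass_out_ball; apply: contra yb; apply/fintype.subsetP.
by apply: ball_subset; rewrite -ltnS.
Qed.

Lemma load_start_gt0 x r s : 0 < x 0 -> 0 < load x r s s.2.
Proof.
move=> x0; rewrite /load big_ord_recl; apply: ltr_wpDr.
  apply: sumr_ge0 => i _; rewrite mulr_ge0 ?sqr_ge0// sumr_ge0// => z _.
  exact: walk_mass_ge0.
rewrite mulr_gt0 ?exprn_gt0// (bigD1 s.1)//= -surjective_pairing eqxx.
by apply: ltr_wpDr => //; apply: sumr_ge0.
Qed.

(** The load vanishes off the ball, so sums over [T] restrict to it; [0 < x 0] makes the test vector
    nonzero at the centre. *)
Lemma load_rayleigh_le_lambda1 (x : nat -> R) r s (l : R) : 0 < x 0 ->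
  l * (\sum_y load x r s y) <= \sum_y \sum_(z | e y z)
     Num.sqrt (load x r s y) * w0 R e y z * Num.sqrt (load x r s z) ->
  l <= lambda1_ball R e s.2 r.
Proof.
move=> x0 lL; set B := ball e s.2 r.
pose F : 'rV[R]_#|B| := \row_i Num.sqrt (load x r s (enum_val i)).
have sumB (f : T -> R) : (forall y, y \notin B -> f y = 0) ->
    \sum_y f y = \sum_(i < #|B|) f (enum_val i).
  move=> f0; rewrite -(big_enum_val f) [RHS]big_mkcond/=.
  by apply: eq_bigr => y _; case: ifPn => // /f0.
have load0 y : y \notin B -> load x r s y = 0 by exact: load_out_ball.
have s2B : s.2 \in B.
  apply: contraT => /load0 l0.
  by have := load_start_gt0 x r s x0; rewrite l0 ltxx.
apply: (@rayleigh_le_spectral_radius _ _ _ _ F).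
- apply/matrixP => i j; rewrite !mxE sym_e; case: ifP => // _.
  by rewrite /w0 mulnC.
- apply/eqP => /rowP/(_ (enum_rank_in s2B s.2)); rewrite !mxE enum_rankK_in//.
  by apply/eqP; rewrite gt_eqF// sqrtr_gt0 load_start_gt0.
have -> : \sum_i F 0 i ^+ 2 = \sum_y load x r s y.
  rewrite sumB//; apply: eq_bigr => i _.
  by rewrite mxE sqr_sqrtr// load_ge0.
apply: le_trans lL _; rewrite sumB; last first.
  by move=> y yB; rewrite big1// => z _; rewrite load0// sqrtr0 !mul0r.
apply: ler_sum => i _; rewrite big_mkcond sumB/=; last first.
  by move=> y yB; case: ifP => // _; rewrite (load0 y)// sqrtr0 mulr0.
apply: ler_sum => j _; rewrite !mxE; case: ifP => // _.
by rewrite mulr0 mul0r.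
Qed.

(** * Jensen bound for the mean edge weight *)

Lemma sum_adj_weight_ge : 2 <= avg_deg R e ->
  (\sum_u deg e u)%:R * (Num.sqrt (avg_deg R e - 1) / avg_deg2 R e) <=
  \sum_y \sum_(z | e y z) adj_weight y z * Num.sqrt (branching y)%:R.
Proof.
move=> d2; set d := avg_deg R e in d2 *; set t := avg_deg2 R e.
set m := (\sum_u deg e u)%:R : R.
have ln_sqrt (a : R) : 0 < a -> ln (Num.sqrt a) = ln a / 2.
  move=> a0; rewrite -[in RHS](sqr_sqrtr (ltW a0)) lnXn ?sqrtr_gt0//.
  by rewrite mulr2n; lra.
have m_neq0 : m != 0.
  apply: contraTneq d2; rewrite /d /avg_deg -/m => ->.
  by rewrite mul0r -ltNge.
have m0 : 0 < m by rewrite lt_def m_neq0 ler0n.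
(* Division by zero gives 0, so [2 <= d] excludes an empty vertex set. *)
have T_neq0 : #|T|%:R != 0 :> R.
  by apply: contraTneq d2; rewrite /d /avg_deg => ->; rewrite invr0 mulr0 -ltNge.
have sum2 : \sum_u (deg e u)%:R ^+ 2 = m * t.
  rewrite /t /avg_deg2 -/m mulrCA divff// mulr1 natr_sum.
  by apply: eq_bigr => u _; rewrite natrX.
have t0 : 0 < t.
  rewrite -(pmulr_rgt0 _ m0) -sum2; apply: lt_le_trans m0 _.
  rewrite /m natr_sum; apply: ler_sum => u _.
  by rewrite -natrX ler_nat; case: (deg e u) => // n; rewrite leq_pmulr.
have sumd : \sum_u ((deg e u)%:R - d) = 0.
  rewrite sumrB sumr_const -natr_sum -/m -[d *+ _]mulr_natr /d /avg_deg -/m.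
  by rewrite divfK// subrr.
have d1 : 0 < d - 1 by lra.
set E := Num.sqrt (d - 1) / t.
have E0 : 0 < E by rewrite divr_gt0// sqrtr_gt0.
have lnE : ln E = ln (d - 1) / 2 - ln t.
  by rewrite ln_div ?posrE ?sqrtr_gt0// ln_sqrt.
pose D y : R := (maxn (deg e y) 2)%:R.
have D0 y : 0 < D y by rewrite ltr0n leq_max orbT.
pose g y z := adj_weight y z * Num.sqrt (branching y)%:R.
have g0 y z : 0 < g y z.
  by rewrite mulr_gt0 ?invr_gt0 ?sqrtr_gt0 ?branching_gt0// natrM mulr_gt0// D0.
have lng y z : ln (g y z) = (ln (branching y)%:R / 2 - ln (D y) / 2) - ln (D z) / 2.
  rewrite /g /adj_weight natrM lnM ?posrE ?invr_gt0 ?sqrtr_gt0 ?branching_gt0//; last first.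
    by rewrite mulr_gt0// D0.
  rewrite lnV ?posrE ?sqrtr_gt0 ?mulr_gt0 ?D0//.
  rewrite !ln_sqrt ?branching_gt0 ?mulr_gt0 ?D0//.
  by rewrite lnM ?posrE ?D0//; rewrite /D; field.
have sum_const (f : T -> R) : \sum_y \sum_(z | e y z) f y = \sum_y (deg e y)%:R * f y.
  apply: eq_bigr => y _; transitivity (f y *+ deg e y); last by rewrite mulr_natl.
  by rewrite sumr_const; congr (_ *+ _); apply: eq_card => z; rewrite !inE.
have sum_ln : m * ln E <= \sum_y \sum_(z | e y z) ln (g y z).
  under eq_bigr do under eq_bigr do rewrite lng.
  under eq_bigr do rewrite sumrB.
  (* Reversing edges moves the half-logarithm at [z] to [y], leaving one term per vertex, weighted
     by its degree. *)
  rewrite sumrB sum_const (sum_edges_swap (fun y z => ln (D y) / 2)) sum_const -sumrB.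
  apply: le_trans (_ : _ <= \sum_y ((deg e y)%:R * ln E
     + ((deg e y)%:R - d) * (d / (d - 1)) / 2
     - (deg e y)%:R * ((deg e y)%:R / t - 1))) _; last first.
    apply: ler_sum => y _; rewrite lnE.
    apply: le_trans (degree_log_tangent _ _ _ _ d2 t0) _.
    by rewrite -mulrBr ler_wpM2l// /D /branching; lra.
  rewrite sumrB big_split/= -!mulr_suml sumd !mul0r addr0 -natr_sum -/m.
  under eq_bigr do rewrite mulrBr mulr1 mulrA -expr2.
  by rewrite sumrB -mulr_suml sum2 mulfK ?gt_eqF// -natr_sum -/m subrr subr0.
(* The tangent to [exp] at [ln E]: a bound on the mean of the logarithms suffices. *)
have g_ge y z : E * (1 - ln E + ln (g y z)) <= g y z.
  have := @ln_le_subr1 R (g y z / E) (divr_gt0 (g0 _ _) E0).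
  rewrite ln_div ?posrE// => /(ler_wpM2l (ltW E0)).
  rewrite mulrBr mulrBr [E * (_ / _)]mulrC divfK ?gt_eqF//; lra.
apply: le_trans (_ : _ <= \sum_y \sum_(z | e y z) (E * (1 - ln E + ln (g y z)))) _.
  under eq_bigr do rewrite -mulr_sumr big_split/=.
  rewrite -mulr_sumr big_split/= sum_const -mulr_suml -natr_sum -/m mulrC.
  by rewrite ler_wpM2l ?(ltW E0)//; lra.
by apply: ler_sum => y _; apply: ler_sum => z _; exact: g_ge.
Qed.

End ReflectingWalk.

(** * Sine profile and choice of the starting edge *)

Theorem theorem4p3 (R : realType) (T : finType) (e : rel T)
  (He : simple_graph e) (Hd : 2 <= avg_deg R e) (r : nat) (Hr : (1 <= r)%N) :
  exists v : T,
    (2 * Num.sqrt (avg_deg R e - 1)) / avg_deg2 R e * cos (pi / (r + 2)%:R)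
      <= lambda1_ball R e v r.
Proof.
have [sym_e _] := He.
set t := pi / (r + 2)%:R.
pose x (i : nat) : R := sin (i.+1%:R * t).
have tr : r.+2%:R * t = pi by rewrite /t addn2 mulrC divfK ?pnatr_eq0.
have t0 : 0 < t by rewrite divr_gt0 ?pi_gt0// ltr0n addn2.
have x_ge0 i : (i <= r.+1)%N -> 0 <= x i.
  move=> ir; apply: sin_ge0_pi; rewrite mulr_ge0 ?ler0n ?(ltW t0)//=.
  by rewrite -tr ler_wpM2r ?(ltW t0)// ler_nat ltnS.
have x0 : 0 < x 0.
  by apply: sin_gt0_pi; rewrite mul1r t0/= -tr ltr_pMl// ltr1n.
have xx : 2 * (\sum_(i < r) x i * x i.+1) = 2 * cos t * \sum_(i < r.+1) x i ^+ 2.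
  by rewrite -sum_sin_mul_succ tr sinpi mulr0 addr0.
have xx0 : 0 <= 2 * (\sum_(i < r) x i * x i.+1).
  rewrite mulr_ge0// sumr_ge0// => i _.
  by rewrite mulr_ge0 ?x_ge0 ?ltnS// ltnW// ltnS ltnW.
set l := 2 * _ / _ * _.
have [||s _ sl] := @ex_le_of_sum_le R _ (fun s : T * T => e s.1 s.2)
    (fun s => l * \sum_y load R T e x r s y)
    (fun s => \sum_y \sum_(z | e y z) Num.sqrt (load R T e x r s y) *
                w0 R e y z * Num.sqrt (load R T e x r s z)).
(* Averaging needs at least one directed edge; without edges the average degree would be 0. *)
- apply: contrapT => no_edge; have deg0 u : deg e u = 0%N.
    apply/eqP; rewrite -leqn0 leqNgt; apply/negP => /card_gt0P[v].
    by rewrite inE => uv; apply: no_edge; exists (u, v).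
  by move: Hd; rewrite /avg_deg big1// mul0r lern0.
- apply: le_trans (sum_rayleigh_ge R T e sym_e x r).
  rewrite -mulr_sumr sum_load//.
  apply: le_trans (ler_wpM2l xx0 (sum_adj_weight_ge R T e sym_e Hd)).
  rewrite xx le_eqVlt; apply/orP; left; apply/eqP; rewrite /l; ring.
by exists s.2; apply: load_rayleigh_le_lambda1 sl.
Qed.
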